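(* Let $n\ge1$. For $\rho,\sigma\in\mathcal{DORP}_n$, with the starred Green's relations taken in the monoid $\mathcal{DORP}_n$: (a) $(\rho,\sigma)\in\mathcal{L}^*$ if and only if $\mathrm{Im}\,\rho=\mathrm{Im}\,\sigma$; (b) $(\rho,\sigma)\in\mathcal{R}^*$ if and only if $\ker\rho=\ker\sigma$; (c) $(\rho,\sigma)\in\mathcal{H}^*$ if and only if $\mathrm{Im}\,\rho=\mathrm{Im}\,\sigma$ and $\ker\rho=\ker\sigma$; (d) $(\rho,\sigma)\in\mathcal{D}^*$ if and only if $|\mathrm{Im}\,\rho|=|\mathrm{Im}\,\sigma|$.
   Context: Let $[n]=\{1,\dots,n\}$ with its usual order. A partial transformation of $[n]$ is a function $\rho$ whose domain $\mathrm{Dom}\,\rho$ and image $\mathrm{Im}\,\rho$ are subsets of $[n]$ (the empty map is allowed). Maps are written on the right and composed left to right: $x(\rho\sigma)=(x\rho)\sigma$. $\rho$ is isotone if $x\le y$ implies $x\rho\le y\rho$ for all $x,y\in\mathrm{Dom}\,\rho$; antitone if $x\le y$ implies $x\rho\ge y\rho$; monotone if isotone or antitone; decreasing if $x\rho\le x$ for all $x\in\mathrm{Dom}\,\rho$. $\mathcal{DORP}_n$ is the monoid, under composition, of all monotone and decreasing partial transformations of $[n]$. The kernel of $\rho$ is the relation $\ker\rho=\{(x,y)\in\mathrm{Dom}\,\rho\times\mathrm{Dom}\,\rho:x\rho=y\rho\}$. On a semigroup $S$, $\mathcal{L}^*=\{(a,b)\in S\times S:\ \forall x,y\in S^1,\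 ax=ay\iff bx=by\}$, $\mathcal{R}^*=\{(a,b)\in S\times S:\ \forall x,y\in S^1,\ xa=ya\iff xb=yb\}$, $\mathcal{H}^*=\mathcal{L}^*\cap\mathcal{R}^*$, and $\mathcal{D}^*$ is the join of $\mathcal{L}^*$ and $\mathcal{R}^*$ in the lattice of equivalence relations on $S$. *)

(* Defs.v *)
From HB Require Import structures.
From mathcomp Require Import all_boot.
From Corelib Require Import RelationClasses.

Set Implicit Arguments.
Unset Strict Implicit.
Unset Printing Implicit Defensive.

Local Open Scope group_scope.

(* A monoid S satisfies S^1 = S, so the quantifiers over S^1 range over S. *)
Section StarredGreen.
Variable S : monoidType.

Definition Lstar (a b : S) : Prop :=
  forall x y : S, a * x = a * y <-> b * x = b * y.

Definition Rstar (a b : S) : Prop :=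
  forall x y : S, x * a = y * a <-> x * b = y * b.

Definition Hstar (a b : S) : Prop := Lstar a b /\ Rstar a b.

End StarredGreen.

(* The intersection of all equivalence relations containing P and Q, that is,
   their least upper bound among equivalence relations. *)
Definition equiv_join (T : Type) (P Q : T -> T -> Prop) (a b : T) : Prop :=
  forall E : T -> T -> Prop, Equivalence E ->
    (forall x y, P x y -> E x y) -> (forall x y, Q x y -> E x y) -> E a b.

Definition Dstar (S : monoidType) : S -> S -> Prop :=
  equiv_join (@Lstar S) (@Rstar S).

(* The chain {1 < ... < n} is represented by 'I_n = {0 < ... < n - 1}, and
   f x = None means that x lies outside the domain of f. *)
Definition ptransf (n : nat) := {ffun 'I_n -> option 'I_n}.

HB.instance Definition _ n := Finite.copy (ptransf n) {ffun 'I_n -> option 'I_n}.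

Section PartialTransformations.
Variable n : nat.
Implicit Types f g h : ptransf n.

Definition Dom f : {set 'I_n} := [set x | f x != None].

Definition Im f : {set 'I_n} := [set y | [exists x, f x == Some y]].

Definition pker f : {set 'I_n * 'I_n} :=
  [set p | [&& p.1 \in Dom f, p.2 \in Dom f & f p.1 == f p.2]].

Definition isotone f : bool :=
  [forall x, forall y, forall u, forall v,
     [&& f x == Some u, f y == Some v & x <= y] ==> (u <= v)].

Definition antitone f : bool :=
  [forall x, forall y, forall u, forall v,
     [&& f x == Some u, f y == Some v & x <= y] ==> (v <= u)].

Definition monotone f : bool := isotone f || antitone f.

Definition decreasing f : bool :=
  [forall x, forall u, (f x == Some u) ==> (u <= x)].

(* Maps act on the right: pcomp f g applies f first. *)
Definition pcomp f g : ptransf n := [ffun x => obind g (f x)].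

Definition pid : ptransf n := [ffun x => Some x].

Lemma isotoneP f :
  reflect (forall x y u v, f x = Some u -> f y = Some v -> x <= y -> u <= v)
          (isotone f).
Proof.
apply: (iffP idP) => [h x y u v fx fy le|h].
  move/forallP/(_ x)/forallP/(_ y)/forallP/(_ u)/forallP/(_ v): h.
  by rewrite fx fy le !eqxx.
do 4![apply/forallP => ?]; apply/implyP => /and3P[/eqP fx /eqP fy].
exact: h fx fy.
Qed.

Lemma antitoneP f :
  reflect (forall x y u v, f x = Some u -> f y = Some v -> x <= y -> v <= u)
          (antitone f).
Proof.
apply: (iffP idP) => [h x y u v fx fy le|h].
  move/forallP/(_ x)/forallP/(_ y)/forallP/(_ u)/forallP/(_ v): h.
  by rewrite fx fy le !eqxx.
do 4![apply/forallP => ?]; apply/implyP => /and3P[/eqP fx /eqP fy].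
exact: h fx fy.
Qed.

Lemma decreasingP f :
  reflect (forall x u, f x = Some u -> u <= x) (decreasing f).
Proof.
apply: (iffP idP) => [h x u fx|h].
  by move/forallP/(_ x)/forallP/(_ u): h; rewrite fx eqxx.
do 2![apply/forallP => ?]; apply/implyP => /eqP; exact: h.
Qed.

Lemma pcompSome f g x v :
  pcomp f g x = Some v -> exists2 u, f x = Some u & g u = Some v.
Proof. by rewrite ffunE; case: (f x) => //= u gu; exists u. Qed.

Lemma pcompA : associative pcomp.
Proof. by move=> f g h; apply/ffunP=> x; rewrite !ffunE; case: (f x) => //= u; rewrite ffunE. Qed.

Lemma pcomp1f : left_id pid pcomp.
Proof. by move=> f; apply/ffunP=> x; rewrite !ffunE. Qed.

Lemma pcompf1 : right_id pid pcomp.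
Proof. by move=> f; apply/ffunP=> x; rewrite !ffunE; case: (f x) => //= u; rewrite ffunE. Qed.

End PartialTransformations.

HB.instance Definition _ n :=
  isMonoid.Build (ptransf n) (@pcompA n) (@pcomp1f n) (@pcompf1 n).

Definition dorp (n : nat) : {pred ptransf n} :=
  fun f => monotone f && decreasing f.

Lemma dorp_monoid_closed n : umagma_closed (@dorp n).
Proof.
split=> [|f g /andP[mf /decreasingP df] /andP[mg /decreasingP dg]].
  apply/andP; split.
    by apply/orP; left; apply/isotoneP=> x y u v; rewrite !ffunE => -[<-] [<-].
  by apply/decreasingP=> x u; rewrite ffunE => -[<-].
apply/andP; split; last first.
  by apply/decreasingP=> x v /pcompSome[u /df ux /dg vu]; apply: leq_trans ux.
have [/orP[/isotoneP|/antitoneP] hf /orP[/isotoneP|/antitoneP] hg] := (mf, mg);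
  apply/orP; [left; apply/isotoneP|right; apply/antitoneP
             |right; apply/antitoneP|left; apply/isotoneP];
  move=> x y u v /pcompSome[a fx ga] /pcompSome[b fy gb] xy;
  have := hf _ _ _ _ fx fy xy; by [exact: hg ga gb | exact: hg gb ga].
Qed.

Record DORP (n : nat) :=
  MkDORP { DORP_val :> ptransf n; DORP_valP : DORP_val \in @dorp n }.

HB.instance Definition _ n := [isSub for @DORP_val n].
HB.instance Definition _ n := [Finite of DORP n by <:].
HB.instance Definition _ n :=
  SubChoice_isSubMonoid.Build (ptransf n) (@dorp n) (DORP n)
    (dorp_monoid_closed n).

(* Main.v *)
(* The product rho x depends only on the restriction of x to Im rho, and x rho
   only on the values of x up to ker rho (with the points outside Dom rho
   identified with "undefined"); partial identities and maps with a
   single point in their domain separate these data.  For D*, monotonicity makes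
   the kernel classes K_0 < ... < K_(k-1) convex, so sending K_i to i is again
   isotone and decreasing.  Hence rho is R*-related to a map with image
   {0, ..., k-1}, and any two such maps are L*-related. *)
Require Import Defs.
From mathcomp Require Import all_boot.
From Corelib Require Import Setoid.

Set Implicit Arguments.
Unset Strict Implicit.
Unset Printing Implicit Defensive.

(** On [D] the map [g] factors through [f], so [g @: D] is an image of [f @: D]. *)
Lemma leq_card_imset_factor (T U V : finType) (D : {set T}) (f : T -> U)
    (g : T -> V) :
  {in D &, forall x y, f x = f y -> g x = g y} -> #|g @: D| <= #|f @: D|.
Proof.
move=> fg; have [->|[x0 _]] := set_0Vmem D; first by rewrite !imset0 !cards0.
(* The default [g x0] only makes [h] total; it is never taken on [f @: D]. *)
pose h u := if [pick x in D | f x == u] is Some x then g x else g x0.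
suff -> : g @: D = h @: (f @: D) by apply: leq_imset_card.
rewrite -imset_comp; apply: eq_in_imset => x xD /=; rewrite /h.
case: pickP => [y /andP[yD /eqP fyx]|/(_ x)]; last by rewrite xD eqxx.
by apply: fg.
Qed.

Lemma card_ord_lt n k : k <= n -> #|[set i : 'I_n | i < k]| = k.
Proof.
move=> kn; have wi : injective (widen_ord kn).
  by move=> i j /(congr1 val) /= ij; apply: val_inj.
rewrite -[RHS]card_ord -(card_imset _ wi).
congr #|pred_of_set _|; apply/setP => i; rewrite inE; apply/idP/imsetP.
  by move=> ik; exists (Ordinal ik) => //; apply: val_inj.
by move=> [j _ ->] /=.
Qed.

Section PartialMaps.
Variable n : nat.
Implicit Types (f g : ptransf n) (r s : DORP n) (A : {set 'I_n}).

Lemma ImP f v : reflect (exists x, f x = Some v) (v \in Im f).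
Proof. by rewrite inE; apply: (iffP existsP) => -[x] fx; exists x; apply/eqP. Qed.

Lemma pkerE f x y :
  ((x, y) \in pker f) = [&& x \in Dom f, y \in Dom f & f x == f y].
Proof. by rewrite [LHS]inE. Qed.

Lemma pker_Dom f g : pker f = pker g -> Dom f = Dom g.
Proof.
by move=> /setP fg; apply/setP => x; have := fg (x, x);
  rewrite !inE !eqxx !andbT !andbb.
Qed.

(** The common value may be [None], which [pker] does not record as a pair; there the equality of
    domains decides. *)
Lemma pker_eq f g x y : pker f = pker g -> f x = f y -> g x = g y.
Proof.
move=> fg fxy; have /setP/(_ x) := pker_Dom fg; have /setP/(_ (x, y)) := fg.
have /setP/(_ y) := pker_Dom fg; rewrite !inE /= fxy eqxx andbT.
case: (f y) => [u|] /=.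
  by move=> <- /esym/and3P[_ _ /eqP].
by move=> /esym/negbFE/eqP -> _ /esym/negbFE/eqP ->.
Qed.

Lemma mulDE r s x : DORP_val (r * s)%g x = obind (DORP_val s) (DORP_val r x).
Proof. exact: ffunE. Qed.

Lemma DORP_eqP r s : DORP_val r =1 DORP_val s <-> r = s.
Proof. by split=> [/ffunP/val_inj|->]. Qed.

(** * Test maps and the relations L* and R* *)

Definition idon A : ptransf n := [ffun x => if x \in A then Some x else None].

Lemma idon_dorp A : idon A \in @dorp n.
Proof.
apply/andP; split.
  apply/orP; left; apply/isotoneP => x y u v; rewrite !ffunE.
  by case: ifP => // _ [<-]; case: ifP => // _ [<-].
by apply/decreasingP => x u; rewrite ffunE; case: ifP => // _ [<-].
Qed.

Definition Idon A : DORP n := MkDORP (idon_dorp A).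

Definition point (b a : 'I_n) : ptransf n :=
  [ffun x => if x == b then Some a else None].

Lemma point_dorp (b a : 'I_n) : a <= b -> point b a \in @dorp n.
Proof.
move=> ab; apply/andP; split.
  apply/orP; left; apply/isotoneP => x y u v; rewrite !ffunE.
  by case: ifP => // _ [<-]; case: ifP => // _ [<-].
by apply/decreasingP => x u; rewrite ffunE; case: eqP => // -> [<-].
Qed.

(** The maps [Idon (Im r)] and [1] agree after [r], hence after [s], which forces every value of [s]
    into [Im r]. *)
Lemma Lstar_Im_sub r s : Lstar r s -> Im s \subset Im r.
Proof.
move=> /(_ (Idon (Im r)) 1%g) [rs _].
have /rs/DORP_eqP sE : (r * Idon (Im r) = r * 1)%g.
  apply/DORP_eqP => x; rewrite !mulDE; case E: (DORP_val r x) => [u|] //=.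
  by rewrite !ffunE; case: ImP => // -[]; exists x.
apply/subsetP => v /ImP[x sx]; move: (sE x).
by rewrite !mulDE sx /= !ffunE; case: ifP.
Qed.

Lemma eq_Im_Lstar r s : Im r = Im s -> Lstar r s.
Proof.
have agree (t x y : DORP n) : (t * x = t * y)%g <->
    {in Im t, DORP_val x =1 DORP_val y}.
  rewrite -DORP_eqP; split=> [txy v /ImP[a ta]|xy a].
    by move: (txy a); rewrite !mulDE ta.
  by rewrite !mulDE; case E: (DORP_val t a) => [v|] //=; apply/xy/ImP; exists a.
by move=> rs x y; rewrite !agree rs.
Qed.

Lemma LstarE r s : Lstar r s <-> Im r = Im s.
Proof.
split=> [rs|]; last exact: eq_Im_Lstar.
by apply/eqP; rewrite eqEsubset !Lstar_Im_sub // => x y; split=> /rs.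
Qed.

Lemma Rstar_pker_sub r s : Rstar r s -> pker r \subset pker s.
Proof.
move=> rs.
(* An equation with the empty map [Idon set0] detects that [x] lies outside the domain. *)
have domE x : (DORP_val r x == None) = (DORP_val s x == None).
  have domP (t : DORP n) :
      (DORP_val t x == None) <-> (Idon [set x] * t = Idon set0 * t)%g.
    rewrite -DORP_eqP; split=> [/eqP tx y|/(_ x)].
      by rewrite !mulDE !ffunE !inE; case: eqP => [->|].
    by rewrite !mulDE !ffunE !inE eqxx /= => ->.
  by apply/idP/idP => /domP/rs/domP.
(* Followed by [r], the one-point map from [b] to [a] and the identity on [b] agree exactly when [r]
   takes equal values at [a] and [b]; the bound [a <= b] makes the one-point map decreasing. *)
have pointE (a b : 'I_n) : a <= b ->
    DORP_val r a = DORP_val r b -> DORP_val s a = DORP_val s b.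
  move=> ab rab; pose p := MkDORP (point_dorp ab).
  have /rs/DORP_eqP/(_ b) : (p * r = Idon [set b] * r)%g.
    by apply/DORP_eqP => x; rewrite !mulDE !ffunE !inE; case: eqP => [->|].
  by rewrite !mulDE !ffunE !inE eqxx.
apply/subsetP => -[a b]; rewrite !inE /= !domE => /and3P[-> -> /eqP rab] /=.
by have [ab|/ltnW ba] := leqP a b; [rewrite (pointE a b)|rewrite (pointE b a)].
Qed.

(** Extends [pker_eq] to undefined arguments: [u] and [v] will be the values at one point of two
    left factors. *)
Lemma eq_pker_obind f g (u v : option 'I_n) :
  pker f = pker g -> obind f u = obind f v -> obind g u = obind g v.
Proof.
move=> fg; have None_eq x : f x = None -> g x = None.
  have /setP/(_ x) := pker_Dom fg; rewrite !inE => + fx.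
  by rewrite fx => /esym/negbFE/eqP.
case: u v => [a|] [b|] //=; first exact: pker_eq.
  exact: None_eq.
by move=> /esym/None_eq ->.
Qed.

Lemma eq_pker_Rstar r s : pker r = pker s -> Rstar r s.
Proof.
move=> rs x y; rewrite -!DORP_eqP.
by split=> E a; move: (E a); rewrite !mulDE; apply: eq_pker_obind.
Qed.

Lemma RstarE r s : Rstar r s <-> pker r = pker s.
Proof.
split=> [rs|]; last exact: eq_pker_Rstar.
by apply/eqP; rewrite eqEsubset !Rstar_pker_sub // => x y; split=> /rs.
Qed.

(** * Image sizes and the numbering of kernel classes *)

Lemma card_Im f : #|Im f| = #|f @: Dom f|.
Proof.
rewrite -(card_imset (Im f) (@Some_inj _)); congr #|pred_of_set _|.
apply/setP => u; apply/imsetP/imsetP => -[x].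
  by move=> /ImP[a fa] ->; exists a; rewrite ?inE fa.
by rewrite inE; case E: (f x) => [v|] // _ ->; exists v => //; apply/ImP; exists x.
Qed.

Lemma pker_card_Im f g : pker f = pker g -> #|Im f| = #|Im g|.
Proof.
have le f' g' : pker f' = pker g' -> #|Im g'| <= #|Im f'|.
  move=> fg; rewrite !card_Im -(pker_Dom fg).
  apply: leq_card_imset_factor => x y _ _; exact: pker_eq.
by move=> fg; apply/eqP; rewrite eqn_leq !le.
Qed.

(** Isotone or antitone, [f] squeezes [f y] between the equal values [f x] and [f z]. *)
Lemma monotone_convex f (x y z : 'I_n) : monotone f ->
  x <= y -> y <= z -> x \in Dom f -> y \in Dom f -> f x = f z -> f y = f x.
Proof.
rewrite !inE => mf xy yz; case fx: (f x) => [a|] // _.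
case fy: (f y) => [b|] // _ /esym fz; congr Some; apply/val_inj/eqP => /=.
by case/orP: mf => [/isotoneP|/antitoneP] mf; rewrite eqn_leq;
  rewrite (mf _ _ _ _ fx fy xy) (mf _ _ _ _ fy fz yz).
Qed.

(* If x lies in the kernel class K_i, then before f x has exactly i elements. *)
Definition before f (x : 'I_n) : {set option 'I_n} :=
  f @: [set y in Dom f | (y < x) && (f y != f x)].

(** Exactly [x] points of the zero-based chain lie below [x]; this makes [standard] decreasing. *)
Lemma card_before_leq f x : #|before f x| <= x.
Proof.
apply: leq_trans (leq_imset_card _ _) _.
rewrite -[X in _ <= X](card_ord_lt (ltnW (ltn_ord x))).
by apply/subset_leq_card/subsetP => y; rewrite !inE => /and3P[].
Qed.

Lemma before_ltn f x : x \in Dom f -> #|before f x| < #|Im f|.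
Proof.
move=> xD; rewrite card_Im; apply/proper_card/properP; split.
  by apply/imsetS/subsetP => y; rewrite inE => /andP[].
exists (f x); first exact: imset_f.
by apply/imsetP => -[y]; rewrite inE => /and3P[_ _ /eqP ne] e; apply: ne.
Qed.

Lemma before_sub f (x y : 'I_n) : monotone f -> x \in Dom f -> y \in Dom f ->
  x <= y -> before f x \subset before f y.
Proof.
move=> mf xD yD xy; apply/imsetS/subsetP => z; rewrite !inE.
move=> /and3P[zD zx /eqP ne]; rewrite zD (leq_trans zx xy) /=.
(* If [f z = f y], convexity along [z < x <= y] gives [f x = f z], a contradiction. *)
apply/eqP => zy; apply: ne; apply/esym.
by apply: (monotone_convex mf (ltnW zx) xy) => //; rewrite inE.
Qed.

(** The value [f x] witnesses strictness: it belongs to [before f y] but not to [before f x]. *)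
Lemma before_card_ltn f (x y : 'I_n) : monotone f -> x \in Dom f -> y \in Dom f ->
  x <= y -> f x != f y -> #|before f x| < #|before f y|.
Proof.
move=> mf xD yD xy ne; apply/proper_card/properP; split; first exact: before_sub.
exists (f x).
  apply: imset_f; rewrite inE xD ne andbT ltn_neqAle xy andbT.
  by apply: contraNneq ne => /val_inj ->.
by apply/imsetP => -[z]; rewrite inE => /and3P[_ _ /eqP ne'] e; apply: ne'.
Qed.

Lemma before_eq f (x y : 'I_n) : monotone f -> x \in Dom f -> y \in Dom f ->
  f x = f y -> before f x = before f y.
Proof.
move=> mf; wlog xy : x y / x <= y.
  move=> th xD yD e; have [xy|/ltnW yx] := leqP x y; first exact: th.
  by apply/esym/th.
move=> xD yD e; apply/eqP; rewrite eqEsubset before_sub //=.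
apply/imsetS/subsetP => z; rewrite !inE e => /and3P[zD zy ne].
(* If [x <= z < y], convexity would put [z] in the class of [x] and [y]. *)
rewrite zD ne andbT /= ltnNge; apply: contra ne => xz; rewrite -e.
by apply/eqP/(monotone_convex mf xz (ltnW zy)) => //; rewrite inE.
Qed.

Lemma before_card_eq f (x y : 'I_n) : monotone f -> x \in Dom f -> y \in Dom f ->
  (#|before f x| == #|before f y|) = (f x == f y).
Proof.
move=> mf; wlog xy : x y / x <= y.
  move=> th xD yD; have [xy|/ltnW yx] := leqP x y; first exact: th.
  by rewrite eq_sym th // eq_sym.
move=> xD yD; have [e|ne] := eqVneq (f x) (f y).
  by rewrite (before_eq mf xD yD e) eqxx.
by apply/negbTE; rewrite neq_ltn before_card_ltn.
Qed.

Lemma before_card_lt f x : #|before f x| < n.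
Proof. exact: leq_ltn_trans (card_before_leq f x) (ltn_ord x). Qed.

Definition standard f : ptransf n :=
  [ffun x => if x \in Dom f then Some (Ordinal (before_card_lt f x)) else None].

(** Classes are numbered by their position in the domain, not by their value, so an antitone [f]
    also yields an isotone map. *)
Lemma standard_dorp f : monotone f -> standard f \in @dorp n.
Proof.
move=> mf; apply/andP; split.
  apply/orP; left; apply/isotoneP => x y u v; rewrite !ffunE.
  case: ifP => // xD [<-]; case: ifP => // yD [<-] xy /=.
  exact/subset_leq_card/before_sub.
apply/decreasingP => x u; rewrite ffunE; case: ifP => // _ [<-] /=.
exact: card_before_leq.
Qed.

Lemma pker_standard f : monotone f -> pker (standard f) = pker f.
Proof.
move=> mf; have domE : Dom (standard f) = Dom f.
  by apply/setP => x; rewrite inE ffunE; case: ifP.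
apply/setP => -[x y]; rewrite !pkerE domE.
have [xD|//] := boolP (x \in Dom f); have [yD|//] := boolP (y \in Dom f).
by rewrite !ffunE xD yD; apply: before_card_eq.
Qed.

(** By [before_ltn] the image lies in this initial segment; equal kernels give it [#|Im f|]
    elements, so it fills the segment. *)
Lemma Im_standard f :
  monotone f -> Im (standard f) = [set i : 'I_n | i < #|Im f|].
Proof.
move=> mf; apply/eqP; rewrite eqEcard; apply/andP; split.
  apply/subsetP => v /ImP[x]; rewrite [v \in _]inE ffunE.
  case: ifP => // xD [<-]; exact: before_ltn.
rewrite (pker_card_Im (pker_standard mf)).
by rewrite card_ord_lt // -[X in _ <= X]card_ord max_card.
Qed.

Definition Standard r : DORP n :=
  MkDORP (standard_dorp (proj1 (andP (DORP_valP r)))).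

Lemma Rstar_Standard r : Rstar r (Standard r).
Proof.
by apply/eq_pker_Rstar; rewrite pker_standard //; case/andP: (DORP_valP r).
Qed.

End PartialMaps.

Theorem theorem2p11 (n : nat) (hn : 1 <= n) (rho sigma : DORP n) :
  [/\ Lstar rho sigma <-> Im rho = Im sigma,
      Rstar rho sigma <-> pker rho = pker sigma,
      Hstar rho sigma <-> Im rho = Im sigma /\ pker rho = pker sigma
    & Dstar rho sigma <-> #|Im rho| = #|Im sigma|].
Proof.
split; [exact: LstarE|exact: RstarE|by rewrite /Hstar LstarE RstarE|split].
  (* Having images of equal size is an equivalence containing L* and R*, hence contains their
     join. *)
  move=> /(_ (fun r s : DORP n => #|Im r| = #|Im s|)); apply.
  - by split=> [r|r s|r s t] // -> .
  - by move=> r s /LstarE ->.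
  - by move=> r s /RstarE; apply: pker_card_Im.
move=> card_eq E [Er Es Et] EL ER.
(* The chain is [rho] R* [Standard rho] L* [Standard sigma] R* [sigma]. *)
apply: (Et _ _ _ (ER _ _ (Rstar_Standard rho))).
apply: (Et _ _ _ _ (Es _ _ (ER _ _ (Rstar_Standard sigma)))).
apply/EL/LstarE; rewrite /= !Im_standard ?card_eq //.
  by case/andP: (DORP_valP sigma).
by case/andP: (DORP_valP rho).
Qed.
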